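(* Let $s,t$ be real numbers and let $(G_n)_{n\ge0}$ be defined by $G_0=t-s$, $G_1=s$, $G_{n+1}=G_n+G_{n-1}$. Let $n\ge0$, $k\ge1$ and $m\ge3$ be integers. The area of the $m$-sided polygon with vertices, in order, $V_i=(G_{n+2ik},G_{n+(2i+1)k})$ for $i=0,1,\dots,m-1$ equals $$\frac{|s^2+st-t^2|}{2}\left|(m-1)F_kF_{2k}-F_kF_{(2m-2)k}\right|.$$
   Context: $F_n$ denotes the Fibonacci numbers ($F_0=0$, $F_1=1$, $F_{n+1}=F_n+F_{n-1}$). The area of a polygon with vertices $(x_1,y_1),\dots,(x_m,y_m)$ taken in this order is given by the shoelace formula $\frac12\left|\sum_{i=1}^{m}(x_iy_{i+1}-x_{i+1}y_i)\right|$, indices taken mod $m$. *)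

(* Defs.v *)
From mathcomp Require Import all_boot all_order all_algebra.
From mathcomp Require Import reals.

Set Implicit Arguments.
Unset Strict Implicit.
Unset Printing Implicit Defensive.

Import Order.TTheory GRing.Theory Num.Theory.

Local Open Scope ring_scope.

Fixpoint fib (n : nat) : nat :=
  match n with
  | 0 => 0
  | n1.+1 => if n1 is n2.+1 then (fib n1 + fib n2)%N else 1
  end.

Fixpoint gib (R : realType) (s t : R) (n : nat) : R :=
  match n with
  | 0 => t - s
  | n1.+1 => if n1 is n2.+1 then gib s t n1 + gib s t n2 else s
  end.

(* The shoelace formula; [ordS i] is [i + 1] taken mod [m], so the last vertex
   is joined to the first one. *)
Definition polygon_area (R : realType) (m : nat) (V : 'I_m -> R * R) : R :=
  2^-1 * `|\sum_(i < m) ((V i).1 * (V (ordS i)).2 - (V (ordS i)).1 * (V i).2)|.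

(* Main.v *)
(* Vajda's identity
     G_(a+i) G_(a+j) - G_a G_(a+i+j) = (-1)^a (s^2 + s t - t^2) F_i F_j
   evaluates every shoelace term. Since all the indices n + 2 i k have the
   parity of n, the m - 1 terms joining consecutive vertices are all equal, and
   the closing edge contributes with the opposite sign. *)
Require Import Defs.
From mathcomp Require Import all_boot all_order all_algebra.
From mathcomp Require Import reals.
From mathcomp Require Import ring zify.

Set Implicit Arguments.
Unset Strict Implicit.
Unset Printing Implicit Defensive.

Import Order.TTheory GRing.Theory Num.Theory.

Local Open Scope ring_scope.

(** Induction of the shape of the order-two recurrences of [fib] and [gib]. *)
Lemma nat_ind2 (P : nat -> Prop) :
  P 0 -> P 1 -> (forall n, P n -> P n.+1 -> P n.+2) -> forall n, P n.
Proof.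
move=> P0 P1 PS n; suff [] : P n /\ P n.+1 by [].
by elim: n => [//|n [Pn Pn1]]; split=> //; exact: PS.
Qed.

Section Vajda.
Variables (R : realType) (s t : R).
Local Notation G := (gib s t).

Lemma fibSS n : fib n.+2 = (fib n.+1 + fib n)%N.
Proof. by []. Qed.

Lemma gibSS n : G n.+2 = G n.+1 + G n.
Proof. by []. Qed.

(** The recurrence makes the left side change sign when [a] grows by one; at [a = 0] it is
    [s ^+ 2 - (t - s) * t]. *)
Lemma gib_cassini a :
  G a.+1 ^+ 2 - G a * G a.+2 = (-1) ^+ a * (s ^+ 2 + s * t - t ^+ 2).
Proof.
elim: a => [|a IH]; first by rewrite /=; ring.
by rewrite [(-1) ^+ _]exprS -mulrA -IH !gibSS; ring.
Qed.

(** Both sides obey the Fibonacci recurrence in [j], and [j = 1] is Cassini. *)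
Lemma gib_docagne a j :
  G a.+1 * G (a + j)%N - G a * G (a + j).+1
  = (-1) ^+ a * (s ^+ 2 + s * t - t ^+ 2) * (fib j)%:R.
Proof.
elim/nat_ind2: j => [||j IH0 IH1].
- by rewrite addn0 /=; ring.
- by rewrite addn1 -gib_cassini /=; ring.
- rewrite fibSS natrD mulrDr -IH0 -IH1 !addnS.
  by rewrite (gibSS (a + j).+1) (gibSS (a + j)); ring.
Qed.

(** Same argument in [i]; the case [i = 1] is [gib_docagne]. *)
Lemma gib_vajda a i j :
  G (a + i)%N * G (a + j)%N - G a * G (a + i + j)%N
  = (-1) ^+ a * (s ^+ 2 + s * t - t ^+ 2) * (fib i)%:R * (fib j)%:R.
Proof.
elim/nat_ind2: i => [||i IH0 IH1].
- by rewrite addn0 /=; ring.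
- by rewrite addn1 addSn gib_docagne /=; ring.
- rewrite fibSS natrD mulrDr mulrDl -IH0 -IH1 !addnS !addSn.
  by rewrite (gibSS (a + i)) (gibSS (a + i + j)); ring.
Qed.

End Vajda.

Theorem theorem3p3 (R : realType) (s t : R) (n k m : nat)
    (hk : (1 <= k)%N) (hm : (3 <= m)%N) :
  polygon_area
    (fun i : 'I_m => (gib s t (n + 2 * i * k)%N,
                      gib s t (n + (2 * i + 1) * k)%N)) =
  `|s ^+ 2 + s * t - t ^+ 2| / 2 *
  `|(m%:R - 1) * (fib k)%:R * (fib (2 * k)%N)%:R
    - (fib k)%:R * (fib ((2 * m - 2) * k)%N)%:R|.
Proof.
(* From here [m] is the number of sides minus one; the closing edge is split off. *)
case: m hm => // m _; rewrite /polygon_area big_ord_recr /=.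
set D := s ^+ 2 + s * t - t ^+ 2.
(* The value of each non-closing edge: Vajda at [n + 2 * i * k] with shifts [k] and [2 * k],
   negated. *)
set c := - ((-1) ^+ n * D * (fib k)%:R * (fib (2 * k))%:R).
rewrite (eq_bigr (fun=> c)); last first.
  move=> i _; rewrite modn_small ?ltnS //.
  have -> : (n + 2 * i.+1 * k = n + 2 * i * k + 2 * k)%N by lia.
  have -> : (n + (2 * i.+1 + 1) * k = n + 2 * i * k + k + 2 * k)%N by lia.
  have -> : (n + (2 * i + 1) * k = n + 2 * i * k + k)%N by lia.
  have := gib_vajda s t (n + 2 * i * k) k (2 * k).
  rewrite exprD -mulnA exprM sqrrN !expr1n mulr1 -/D => /(congr1 -%R).
  by rewrite -/c => <-; ring.
rewrite modnn sumr_const card_ord !muln0 !mul0n !addn0 add0n mul1n.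
have -> : (n + (2 * m + 1) * k = n + k + 2 * m * k)%N by lia.
have -> : ((2 * m.+1 - 2) * k = 2 * m * k)%N by lia.
(* The closing edge is Vajda at [n] with shifts [k] and [2 * m * k], not negated. *)
rewrite [gib s t (n + _) * _]mulrC (gib_vajda s t n k (2 * m * k)) -/D.
rewrite (_ : c *+ m + _ = - (-1) ^+ n * (D * ((m.+1%:R - 1) * (fib k)%:R *
  (fib (2 * k))%:R - (fib k)%:R * (fib (2 * m * k))%:R))); last first.
  by rewrite /c -mulr_natr -natr1; ring.
by rewrite normrM normrN normrX normrN1 expr1n mul1r normrM mulrA [2^-1 * _]mulrC.
Qed.
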